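(* Let $p$ be an odd prime, $m,s$ positive integers, and $\mathcal{R}=\mathbb{F}_{p^m}[u,v]/\langle u^2,v^2,uv-vu\rangle$. Let $\alpha=\alpha_1+\alpha_2u+\alpha_3v+\alpha_4uv\in\mathcal{R}$ with $\alpha_1,\alpha_2,\alpha_3\in\mathbb{F}_{p^m}^*$, $\alpha_4\in\mathbb{F}_{p^m}$, and suppose $\alpha$ is not a square in $\mathcal{R}$. Let $\alpha_0\in\mathbb{F}_{p^m}$ be the element with $\alpha_0^{p^s}=\alpha_1$. Let $\mathcal{C}=\langle (x^2-\alpha_0)^\ell+u(x^2-\alpha_0)^tz(x),\ u(x^2-\alpha_0)^\mu\rangle$ be the ideal of $\mathcal{R}_\alpha=\mathcal{R}[x]/\langle x^{2p^s}-\alpha\rangle$, where $0\le\ell\le 2p^s-1$, $0\le t<\ell$, $z(x)$ is $0$ or a unit, and $0\le\mu<\Im$, where $\Im$ is the smallest non-negative integer such that $u(x^2-\alpha_0)^{\Im}\in\langle (x^2-\alpha_0)^\ell+u(x^2-\alpha_0)^tz(x)\rangle$. Then the symbol-pair distance of $\mathcal{C}$ is $$d_{sp}(\mathcal{C})=\begin{cases}2 & \text{if } 0\le\mu\le p^s;\\ 2(\Gamma+1)p^{\gamma} & \text{if } 2p^s-p^{s-\gamma}+(\Gamma-1)p^{s-\gamma-1}+1\le\mu\le 2p^s-p^{s-\gamma}+\Gamma p^{s-\gamma-1},\\ & \text{where } 1\le\Gamma\le p-1 \text{ and } 0\le\gamma\le s-1.\end{cases}$$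
   Context: Elements of $\mathcal{R}_\alpha=\mathcal{R}[x]/\langle x^{2p^s}-\alpha\rangle$ are identified with vectors in $\mathcal{R}^{2p^s}$: the class whose representative of degree less than $2p^s$ is $\zeta_0+\zeta_1x+\cdots+\zeta_{2p^s-1}x^{2p^s-1}$ corresponds to $(\zeta_0,\ldots,\zeta_{2p^s-1})$. Ideals of $\mathcal{R}_\alpha$ are thereby the $\alpha$-constacyclic codes of length $2p^s$ over $\mathcal{R}$. For vectors $x=(x_0,\ldots,x_{n-1})$, $y=(y_0,\ldots,y_{n-1})$ over an alphabet, the symbol-pair distance is $d_{sp}(x,y)=|\{i:0\le i\le n-1,\ (x_i,x_{i+1})\ne(y_i,y_{i+1})\}|$, indices taken modulo $n$; for a code $\mathcal{C}$ with at least two words, $d_{sp}(\mathcal{C})=\min\{d_{sp}(x,y):x,y\in\mathcal{C},x\ne y\}$. When $z(x)$ is a unit, it is represented as a finite sum $z(x)=\sum_{\kappa}(z_{0\kappa}x+z_{1\kappa})(x^2-\alpha_0)^\kappa$ with $z_{0\kappa},z_{1\kappa}\in\mathbb{F}_{p^m}$ and $z_{00}x+z_{10}\ne0$. *)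

(* Defs.v *)
From mathcomp Require Import all_boot all_order all_algebra.

Set Implicit Arguments.
Unset Strict Implicit.
Unset Printing Implicit Defensive.

Import GRing.Theory.
Local Open Scope ring_scope.

Definition is_unit (A : comNzRingType) (a : A) : Prop := exists b, a * b = 1.

Definition in_ideal (A : comNzRingType) (gs : seq A) (c : A) : Prop :=
  exists a : 'I_(size gs) -> A, c = \sum_(i < size gs) a i * gs`_i.

Definition is_least (P : nat -> Prop) (n : nat) : Prop :=
  P n /\ forall k, P k -> (n <= k)%N.

(* F[u,v]/<u^2, v^2, uv - vu>, built as (F[u]/<u^2>)[v]/<v^2>; see [uuE], [vvE]
   and [Ruv_basis]. *)
Definition Ru (F : fieldType) := {poly %/ ('X^2 : {poly F})}.

Definition Ruv (F : fieldType) := {poly %/ ('X^2 : {poly (Ru F)})}.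

Definition injF (F : fieldType) (a : F) : Ruv F := qpolyC _ (qpolyC _ a : Ru F).
Definition uu (F : fieldType) : Ruv F := qpolyC _ ('qX : Ru F).
Definition vv (F : fieldType) : Ruv F := 'qX.

Lemma qX2E (A : comNzRingType) (a b : A) :
  (qpolyC _ a + qpolyC _ b * 'qX : {poly %/ ('X^2 : {poly A})})
  = a%:P + b%:P * 'X :> {poly A}.
Proof.
have mk2 : mk_monic ('X^2 : {poly A}) = 'X^2 by rewrite mk_monic_Xn.
rewrite /= Pdiv.RingMonic.rmodp_mulmr ?monic_mk_monic //.
congr (_ + _); apply: Pdiv.CommonRing.rmodp_small.
rewrite mk2 size_polyXn mul_polyC.
by rewrite (leq_ltn_trans (size_scale_leq _ _)) ?size_polyX.
Qed.

Lemma qX2_coef (A : comNzRingType) (r : {poly %/ ('X^2 : {poly A})}) :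
  r = qpolyC _ r`_0 + qpolyC _ r`_1 * 'qX.
Proof.
apply/val_inj; rewrite [RHS]qX2E /=.
have sr : (size (r : {poly A}) <= 2)%N.
  by rewrite (leq_trans (size_npoly r)) // mk_monic_Xn size_polyXn.
apply/polyP => i; rewrite coefD coefCM coefC coefX.
case: i => [|[|i]] /=; rewrite ?mulr0 ?mulr1 ?addr0 ?add0r //.
by rewrite nth_default // (leq_trans sr).
Qed.

Lemma qX2_uniq (A : comNzRingType) (a b : A) :
  let r : {poly %/ ('X^2 : {poly A})} := qpolyC _ a + qpolyC _ b * 'qX in
  r`_0 = a /\ r`_1 = b.
Proof.
move=> r; have -> : r = a%:P + b%:P * 'X :> {poly A} := qX2E a b.
by rewrite !coefD !coefCM !coefC !coefX /= mulr0 mulr1 addr0 add0r.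
Qed.

Lemma qX2_sq (A : comNzRingType) :
  ('qX : {poly %/ ('X^2 : {poly A})}) ^+ 2 = 0.
Proof.
rewrite /qpolyX -rmorphXn /=; apply/val_inj => /=.
by rewrite mk_monic_Xn /= Pdiv.RingMonic.rmodpp ?monicXn.
Qed.

Lemma uuE (F : fieldType) : uu F ^+ 2 = 0.
Proof. by rewrite /uu -rmorphXn /= qX2_sq rmorph0. Qed.

Lemma vvE (F : fieldType) : vv F ^+ 2 = 0.
Proof. exact: qX2_sq. Qed.

Lemma Ruv_basis (F : fieldType) (r : Ruv F) :
  exists! c : F * F * F * F, let: (a1, a2, a3, a4) := c in
  r = injF a1 + injF a2 * uu F + injF a3 * vv F + injF a4 * (uu F * vv F).
Proof.
have E (a1 a2 a3 a4 : F) :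
  injF a1 + injF a2 * uu F + injF a3 * vv F + injF a4 * (uu F * vv F)
  = qpolyC _ (qpolyC _ a1 + qpolyC _ a2 * 'qX : Ru F)
    + qpolyC _ (qpolyC _ a3 + qpolyC _ a4 * 'qX : Ru F) * 'qX.
  by rewrite /injF /uu /vv !rmorphD !rmorphM /= mulrDl !mulrA !addrA.
exists ((r`_0 : Ru F)`_0, (r`_0 : Ru F)`_1, (r`_1 : Ru F)`_0, (r`_1 : Ru F)`_1).
split; first by rewrite E -!qX2_coef.
move=> [[[a1 a2] a3] a4] ->; rewrite E.
set r0 : Ru F := qpolyC _ a1 + _; set r1 : Ru F := qpolyC _ a3 + _.
have [-> ->] := qX2_uniq r0 r1.
have [-> ->] := qX2_uniq a1 a2.
by have [-> ->] := qX2_uniq a3 a4.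
Qed.

Definition Rquo (F : fieldType) (n : nat) (alpha : Ruv F) :=
  {poly %/ ('X^n - alpha%:P : {poly (Ruv F)})}.

(* The quotient really is by X^n - alpha (not by the default modulus of
   {poly %/ _}) as soon as n > 0, so representatives have degree < n. *)
Lemma mk_monic_Rquo (F : fieldType) (n : nat) (alpha : Ruv F) :
  (0 < n)%N -> mk_monic ('X^n - alpha%:P) = 'X^n - alpha%:P.
Proof.
by move=> n0; rewrite /mk_monic size_XnsubC // ltnS n0 monicXnsubC.
Qed.

Section Quotient.
Variables (F : fieldType) (n : nat) (alpha : Ruv F).
Local Notation Q := (Rquo n alpha).

Definition qconst (r : Ruv F) : Q := qpolyC _ r.
Definition qx : Q := 'qX.
Definition qu : Q := qconst (uu F).
Definition qy (alpha0 : F) : Q := qx ^+ 2 - qconst (injF alpha0).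

Lemma qx_exp : (0 < n)%N -> qx ^+ n = qconst alpha.
Proof.
move=> n0; rewrite /qx /qpolyX -rmorphXn /=.
rewrite -[X in in_qpoly _ X](subrK alpha%:P) rmorphD /=.
have -> : in_qpoly ('X^n - alpha%:P) ('X^n - alpha%:P) = 0.
  apply/val_inj => /=; set h := 'X^n - _.
  by rewrite -[X in Pdiv.CommonRing.rmodp X](mk_monic_Rquo alpha n0)
             Pdiv.RingMonic.rmodpp ?monic_mk_monic.
rewrite add0r; apply/val_inj => /=.
by rewrite Pdiv.CommonRing.rmodp_small // mk_monic_Rquo // size_XnsubC // size_polyC;
   case: eqP.
Qed.

Definition qterm (a b : F) : Q := qconst (injF a) * qx + qconst (injF b).

Definition is_represented_unit (alpha0 : F) (z : Q) : Prop :=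
  is_unit z /\
  exists (N : nat) (z0 z1 : nat -> F),
    qterm (z0 0%N) (z1 0%N) <> 0 /\
    z = \sum_(k < N.+1) qterm (z0 k) (z1 k) * qy alpha0 ^+ k.

Definition word (c : Q) : 'rV[Ruv F]_n := poly_rV (c : {poly (Ruv F)}).

Definition code (I : Q -> Prop) (w : 'rV[Ruv F]_n) : Prop :=
  exists c : Q, I c /\ w = word c.

End Quotient.

Arguments qu {F n alpha}.
Arguments qy {F n alpha} alpha0.

Definition pair_dist (A : eqType) (n : nat) (x y : 'rV[A]_n) : nat :=
  #|[set i : 'I_n | (x 0 i, x 0 (ordS i)) != (y 0 i, y 0 (ordS i))]|.

(* In particular C has at least two words. *)
Definition is_pair_dist_of (A : eqType) (n : nat) (C : 'rV[A]_n -> Prop)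
    (d : nat) : Prop :=
  (exists x y, [/\ C x, C y, x <> y & pair_dist x y = d]) /\
  (forall x y, C x -> C y -> x <> y -> (d <= pair_dist x y)%N).

(* Main.v *)
From HB Require Import structures.
Require Import Defs.
From mathcomp Require Import all_boot all_order all_algebra all_field.
From mathcomp Require Import zify ring.

Set Implicit Arguments.
Unset Strict Implicit.
Unset Printing Implicit Defensive.

Import GRing.Theory.
Local Open Scope ring_scope.

(* Put y = x^2 - alpha0 and n = 2 p^s. In the quotient ring
   y^(p^s) = alpha - alpha1, hence u y^(p^s) = alpha3 uv, and y is nilpotent.
   Multiplying a nonzero codeword by a constant does not increase its pair weight
   and can bring it into uv F[x]; there it is uv f with f in F[x] nonzero of
   degree less than n. Since alpha is not a square, x^2 - alpha0 is irreducible,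
   so f = y^j f1 with f1 a unit of the quotient, and uv y^j, that is
   u y^(p^s + j), lies in C. Minimality of Im then forces p^s + j >= mu, so f is
   divisible by y^(mu - p^s). Conversely C contains uv y^j for p^s + j >= mu.
   Splitting f into its even and odd parts, the pair weight of such f is at least
   twice the least Hamming weight of a nonzero multiple of
   (X - alpha0)^(mu - p^s) of degree less than p^s, which the theorem of Massey,
   Costello and Justesen bounds by a product over base p digits. *)

(** * Hamming weight and symbol-pair weight of polynomials *)

(** For [0 < q], the sections with [j < q] decompose [f] as the sum of [X^j f_j(X^q)]; the length
    [size f] is then ample. *)
Definition section (A : nzRingType) (q j : nat) (f : {poly A}) : {poly A} :=
  \poly_(i < size f) f`_(i * q + j).

Lemma coef_section (A : nzRingType) (q j : nat) (f : {poly A}) (i : nat) :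
  (0 < q)%N -> (section q j f)`_i = f`_(i * q + j).
Proof.
move=> q0; rewrite coef_poly; case: ltnP => // fi.
rewrite nth_default // (leq_trans fi) //.
by rewrite (leq_trans _ (leq_addr _ _)) ?leq_pmulr.
Qed.

(** Taking a section is linear over polynomials in [X^q], with [X^q] acting on the section as
    [X]. *)
Lemma section_mul_XnsubC_exp (A : comNzRingType) (q j e : nat) (c : A)
    (f : {poly A}) :
  (j < q)%N ->
  section q j (('X^q - c%:P) ^+ e * f) = ('X - c%:P) ^+ e * section q j f.
Proof.
move=> jq; have q0 : (0 < q)%N by case: q jq.
elim: e => [|e IH]; first by rewrite !mul1r.
rewrite !exprS -!mulrA -IH; set g := _ ^+ e * f.
apply/polyP => i; rewrite coef_section // !mulrBl !coefB !coefCM coefXnM coefXM.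
rewrite !coef_section //; case: i => [|i] /=; first by rewrite mul0n add0n jq.
by rewrite mulSn ltnNge -addnA leq_addr addKn.
Qed.

Lemma section_sum (A : comNzRingType) (q : nat) (f : {poly A}) :
  (0 < q)%N -> f = \sum_(j < q) 'X^j * (section q j f \Po 'X^q).
Proof.
move=> q0; apply/polyP => i; rewrite coef_sum.
have iq : (i %% q < q)%N by rewrite ltn_mod.
rewrite (bigD1 (Ordinal iq)) //= big1 ?addr0.
  rewrite coefXnM ltnNge leq_mod /= coef_comp_poly_Xn // coef_section //.
  have -> : (i - i %% q = i %/ q * q)%N by rewrite {1}(divn_eq i q) addnK.
  by rewrite dvdn_mull // mulnK // -divn_eq.
move=> j /eqP jne; rewrite coefXnM; case: ltnP => // ji.
rewrite coef_comp_poly_Xn //; case: ifP => // /dvdnP [k Ek].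
case: jne; apply/val_inj => /=.
by rewrite -(subnK ji) Ek modnMDl modn_small.
Qed.

Lemma sum_divmod (N q : nat) (G : nat -> nat) :
  (\sum_(i < N * q) G i = \sum_(j < q) \sum_(i < N) G (i * q + j))%N.
Proof.
rewrite -(big_mkord predT) big_nat_mul exchange_big /= big_mkord.
apply: eq_bigr => i _.
rewrite -{1}[(i * q)%N]add0n big_addn mulSn addnK big_mkord.
by apply: eq_bigr => j _; rewrite addnC.
Qed.

Definition weight (A : nzRingType) (N : nat) (f : {poly A}) : nat :=
  (\sum_(i < N) (f`_i != 0)%R)%N.

Lemma weight_section (A : nzRingType) (N q : nat) (f : {poly A}) :
  (0 < q)%N -> weight (N * q) f = (\sum_(j < q) weight N (section q j f))%N.
Proof.
move=> q0; rewrite /weight (sum_divmod N q (fun i => f`_i != 0 : nat)).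
by apply: eq_bigr => j _; apply: eq_bigr => i _; rewrite coef_section.
Qed.

Lemma weight_gt0 (A : nzRingType) (N : nat) (f : {poly A}) :
  (size f <= N)%N -> f != 0 -> (0 < weight N f)%N.
Proof.
move=> sf f0; have sf0 : (0 < size f)%N by rewrite size_poly_gt0.
have kN : ((size f).-1 < N)%N by rewrite prednK.
by rewrite /weight (bigD1 (Ordinal kN)) //= -lead_coefE lead_coef_eq0 f0.
Qed.

Lemma natr_inj_small (F : fieldType) (p i k : nat) :
  p \in [pchar F] -> (i < p)%N -> (k < p)%N -> i%:R = k%:R :> F -> i = k.
Proof.
move=> pF; wlog ik : i k / (i <= k)%N => [H ip kp E|_ kp E].
  by case/orP: (leq_total i k) => h; [apply: H | apply/esym/H].
have: (p %| k - i)%N by rewrite (dvdn_pcharf pF) natrB // E subrr.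
rewrite /dvdn modn_small ?(leq_ltn_trans (leq_subr _ _)) // subn_eq0 => ki.
by apply/eqP; rewrite eqn_leq ik ki.
Qed.

(* The operator [f |-> X f' - k f] multiplies the coefficient of X^i by i - k:
   in degree less than the characteristic it kills exactly the monomial X^k,
   and it lowers the multiplicity of a root by at most one. *)
Lemma weight_small_degree (F : fieldType) (p : nat) (a : F) (e : nat)
    (f : {poly F}) :
  p \in [pchar F] -> a != 0 -> (size f <= p)%N -> f != 0 ->
  ('X - a%:P) ^+ e %| f -> (e < weight p f)%N.
Proof.
move=> pF a0; elim: e f => [|e IH] f sf f0 dvd; first exact: weight_gt0.
have sf0 : (0 < size f)%N by rewrite size_poly_gt0.
have kp : ((size f).-1 < p)%N by rewrite prednK.
set k := (size f).-1 in kp.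
have fk : f`_k != 0 by rewrite -lead_coefE lead_coef_eq0.
pose g := 'X * f^`() - k%:R *: f.
have gE i : g`_i = (i%:R - k%:R) * f`_i.
  rewrite coefB coefXM coefZ mulrBl; congr (_ - _).
  by case: i => [|i] /=; rewrite ?mul0r ?coef_deriv ?mulr_natl.
have sg : (size g <= p)%N.
  by apply/leq_sizeP => i pi; rewrite gE nth_default ?mulr0 ?(leq_trans sf).
have gd : ('X - a%:P) ^+ e %| g.
  have le : ('X - a%:P) ^+ e %| f by rewrite (dvdp_trans _ dvd) // dvdp_exp2l.
  rewrite /g -mul_polyC dvdp_sub ?(dvdp_mull _ le) // dvdp_mull //.
  case/dvdpP: dvd => h ->; rewrite derivM deriv_exp derivXsubC mul1r /=.
  by rewrite dvdp_add // dvdp_mull ?dvdp_exp2l // -mulr_natr dvdp_mulr.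
have g0 : g != 0.
  apply/eqP => gz.
  have fE i : i != k -> f`_i = 0.
    move=> ik; case: (ltnP i p) => ip; last first.
      by rewrite nth_default // (leq_trans sf).
    move: (gE i); rewrite gz coef0 => /esym/eqP; rewrite mulf_eq0 subr_eq0.
    case/orP => [/eqP/(natr_inj_small pF ip kp)/eqP|/eqP //].
    by rewrite (negPf ik).
  have Ef : f = f`_k *: 'X^k.
    apply/polyP => i; rewrite coefZ coefXn.
    by case: eqP => [->|/eqP/fE ->]; rewrite ?mulr1 ?mulr0.
  move: dvd; rewrite exprS => /(dvdp_trans (dvdp_mulr _ (dvdpp _))).
  rewrite dvdp_XsubCl Ef rootE !hornerE mulf_eq0 (negPf fk).
  by rewrite expf_eq0 (negPf a0) andbF.
apply: leq_ltn_trans (IH g sg g0 gd) _.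
(* Passing from [f] to [g] loses the coefficient of index [k] and creates no new nonzero one. *)
rewrite /weight (bigD1 (Ordinal kp)) //= [X in (_ < X)%N](bigD1 (Ordinal kp)) //=.
rewrite gE subrr mul0r eqxx fk add0n add1n ltnS; apply: leq_sum => i _.
by rewrite gE mulf_eq0 negb_or andbC; case: (_ != 0); rewrite ?leq_b1.
Qed.

(** The product of [d + 1] over the [n] lowest base [p] digits [d] of [e]. By Lucas, for [e < p^n]
    this is the number of nonzero coefficients of [(X - a)^e] with [a] nonzero in characteristic
    [p]. *)
Fixpoint digit_product (p n e : nat) : nat :=
  if n is n'.+1 then ((e %% p).+1 * digit_product p n' (e %/ p))%N else 1%N.

Lemma exprBn_pchar (A : comNzRingType) (x y : A) (q : nat) :
  [pchar A].-nat q -> (x - y) ^+ q = x ^+ q - y ^+ q.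
Proof.
by move=> qA; apply: (addIr (y ^+ q)); rewrite -exprDn_pchar // !subrK.
Qed.

Lemma XnsubC_exp_pchar (A : comNzRingType) (p k n : nat) (a : A) :
  p \in [pchar A] ->
  ('X^k - a%:P) ^+ (p ^ n) = 'X^(k * p ^ n) - (a ^+ (p ^ n))%:P.
Proof.
move=> pA; have pP : p \in [pchar {poly A}] by rewrite pchar_poly.
rewrite exprBn_pchar -?exprM ?polyC_exp //.
by rewrite pnatX (eq_pnat _ (pcharf_eq pP)) pnat_id ?(pcharf_prime pA).
Qed.

(* Massey, Costello and Justesen: split [f] into its residue sections modulo p.
   With e = p e' + e0, every section is divisible by (X - a^p)^e', and the
   values at a^p of the cofactors are the coefficients of a polynomial of degree
   less than p divisible by (X - a)^e0, so at least e0 + 1 of them are nonzero. *)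
Lemma weight_ge_digit_product (F : fieldType) (p n e : nat) (a : F)
    (g : {poly F}) :
  p \in [pchar F] -> a != 0 -> ~~ root g a ->
  (size (('X - a%:P) ^+ e * g)%R <= p ^ n)%N ->
  (digit_product p n e <= weight (p ^ n) (('X - a%:P) ^+ e * g)%R)%N.
Proof.
move=> pF; have p0 : (0 < p)%N := prime_gt0 (pcharf_prime pF).
elim: n e a g => [|n IH] e a g a0 ga sf.
  apply: weight_gt0 => //; rewrite mulf_neq0 ?expf_neq0 ?polyXsubC_eq0 //.
  by apply: contraNneq ga => ->; rewrite root0.
have XpB : ('X - a%:P) ^+ p = 'X^p - (a ^+ p)%:P.
  by have := XnsubC_exp_pchar 1 1 a pF; rewrite expn1 mul1n expr1.
set f := _ * g in sf *; set e0 := (e %% p)%N; set e' := (e %/ p)%N.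
pose h := ('X - a%:P) ^+ e0 * g.
have Ef : f = ('X^p - (a ^+ p)%:P) ^+ e' * h.
  by rewrite /f /h -XpB -exprM mulrA -exprD mulnC -divn_eq.
have b0 : a ^+ p != 0 by rewrite expf_neq0.
(* This is [h] reduced modulo [X^p - a^p]: each section is replaced by its value at [a^p]. *)
pose r := \poly_(j < p) (section p j h).[a ^+ p].
have rh : ('X^p - (a ^+ p)%:P) %| h - r.
  rewrite {1}(section_sum h p0) /r poly_def -sumrB.
  apply: (big_ind (fun q => _ %| q)) => [||j _];
    [exact: dvdp0 | exact: dvdp_add |].
  rewrite -mul_polyC [_%:P * _]mulrC -mulrBr dvdp_mull //.
  have /factor_theorem [k Ek] :
      root (section p j h - ((section p j h).[a ^+ p])%:P) (a ^+ p).
    by rewrite rootE !hornerE subrr.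
  have := congr1 (fun k => k \Po 'X^p) Ek.
  rewrite rmorphB /= comp_polyC => ->.
  by rewrite rmorphM /= rmorphB /= comp_polyX comp_polyC dvdp_mulIr.
rewrite -XpB in rh.
have e0p : (e0 < p)%N by rewrite ltn_mod.
have re0 : ('X - a%:P) ^+ e0 %| r.
  rewrite -[r](subKr h) dvdp_sub // ?dvdp_mulIl //.
  by rewrite (dvdp_trans _ rh) // dvdp_exp2l // ltnW.
(* If [r] were zero, [(X - a)^p] would divide [(X - a)^e0 g] with [e0 < p], and [g] would vanish at
   [a]. *)
have r0 : r != 0.
  apply: contraNneq ga => rz; rewrite -dvdp_XsubCl.
  rewrite rz subr0 in rh.
  rewrite -(@dvdp_mul2l _ (('X - a%:P) ^+ e0)) ?expf_neq0 ?polyXsubC_eq0 //.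
  by rewrite -exprSr -/h (dvdp_trans _ rh) // dvdp_exp2l.
rewrite expnSr weight_section //.
(* Each section with nonzero value at [a^p] contributes the product of the higher digits, and there
   are at least [e0 + 1] of them. *)
apply: leq_trans (_ : (weight p r * digit_product p n e' <= _)%N).
  have e0w := weight_small_degree pF a0 (size_poly _ _) r0 re0.
  by rewrite leq_mul2r [(e0 < _)%N]e0w orbT.
rewrite /weight big_distrl /=; apply: leq_sum => j _.
rewrite coef_poly ltn_ord; case: eqP => [//|/eqP hj]; rewrite mul1n.
rewrite Ef section_mul_XnsubC_exp //; apply: IH => //.
rewrite -section_mul_XnsubC_exp // -Ef.
apply/leq_sizeP => i ni; rewrite coef_section //; apply: nth_default.
rewrite (leq_trans sf) // expnSr (leq_trans _ (leq_addr _ _)) //.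
by rewrite leq_mul2r ni orbT.
Qed.

Lemma digit_productD (p n e d : nat) :
  (d < p)%N -> digit_product p n.+1 (p * e + d) = (d.+1 * digit_product p n e)%N.
Proof.
move=> dp; rewrite /= [(p * e)%N]mulnC modnMDl modn_small // divnMDl.
  by rewrite divn_small ?addn0.
by case: p dp.
Qed.

Lemma digit_product_exp (p n : nat) :
  (0 < p)%N -> digit_product p n (p ^ n).-1 = (p ^ n)%N.
Proof.
move=> p0; elim: n => // n IH.
have -> : (p ^ n.+1).-1 = (p * (p ^ n).-1 + p.-1)%N.
  by have := expn_gt0 p n; rewrite p0 expnS; nia.
by rewrite digit_productD ?IH ?prednK // expnS.
Qed.

(** The threshold has [gamma] digits [p - 1], then [G], then [r] zeros. A larger [e] either raises
    the digit [G], or keeps the leading [gamma + 1] digits and has a nonzero trailing digit, which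
    at least doubles the product; and [2 (G + 1) >= G + 2]. *)
Lemma digit_product_ge (p r gamma G e : nat) :
  (G.+1 < p)%N ->
  (p ^ r * (p * (p ^ gamma).-1 + G) < e)%N -> (e < p ^ (r + gamma.+1))%N ->
  (G.+2 * p ^ gamma <= digit_product p (r + gamma.+1) e)%N.
Proof.
move=> Gp; have p0 : (0 < p)%N by case: p Gp.
set c := (p * _ + G)%N.
have pg : (0 < p ^ gamma)%N by rewrite expn_gt0 p0.
have cE : digit_product p gamma.+1 c = (G.+1 * p ^ gamma)%N.
  by rewrite digit_productD ?digit_product_exp // ltnW.
elim: r e => [|r IH] e; last first.
  have := divn_eq e p; have := ltn_mod e p; rewrite p0.
  set e' := (e %/ p)%N; set d := (e %% p)%N => dp -> ce ep.
  have e'p : (e' < p ^ (r + gamma.+1))%N.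
    by move: ep; rewrite addSn expnS; nia.
  rewrite [(e' * p)%N]mulnC addSn digit_productD //.
  have [lt|le] := ltnP (p ^ r * c) e'.
    by apply: leq_trans (IH _ lt e'p) _; rewrite leq_pmull.
  have [d0 Ee] : (0 < d)%N /\ e' = (p ^ r * c)%N.
    by move: ce; rewrite expnS; split; nia.
  rewrite Ee; apply: (@leq_trans (2 * (G.+1 * p ^ gamma))); first by nia.
  apply: leq_mul => //; rewrite -cE.
  elim: r {IH ce ep e'p le Ee} => [|r IHr]; first by rewrite mul1n.
  by rewrite expnS -mulnA -[(p * _)%N]addn0 addSn digit_productD // mul1n.
rewrite expn0 mul1n add0n => ce.
have := divn_eq e p; have := ltn_mod e p; rewrite p0.
set e' := (e %/ p)%N; set d := (e %% p)%N => dp Ee ep.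
(* The bound [e < p^(gamma + 1)] leaves no room above the leading digits [p - 1], so only the last
   digit can grow. *)
have e'E : e' = (p ^ gamma).-1.
  by move: ep; rewrite expnS; rewrite /c in ce; nia.
rewrite Ee e'E [(_.-1 * p)%N]mulnC digit_productD // digit_product_exp //.
by rewrite leq_mul2r; apply/orP; right; rewrite /c Ee e'E in ce; nia.
Qed.

(** The exponent [k] is replaced by the exact multiplicity [e] of the root [a], so that the cofactor
    does not vanish there; the digit bound holds for every exponent above the threshold. *)
Lemma weight_ge (F : fieldType) (p r gamma G k : nat) (a : F) (f : {poly F}) :
  p \in [pchar F] -> a != 0 -> (G.+1 < p)%N ->
  (p ^ r * (p * (p ^ gamma).-1 + G) < k)%N ->
  (size f <= p ^ (r + gamma.+1))%N -> f != 0 -> ('X - a%:P) ^+ k %| f ->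
  (G.+2 * p ^ gamma <= weight (p ^ (r + gamma.+1)) f)%N.
Proof.
move=> pF a0 Gp ck sf f0 dvd.
have [e [g]] := multiplicity_XsubC f a; rewrite f0 mulrC /= => ga Ef.
have ke : (k <= e)%N.
  rewrite leqNgt; apply: contra ga => ek; rewrite -dvdp_XsubCl.
  rewrite -(@dvdp_mul2l _ (('X - a%:P) ^+ e)) ?expf_neq0 ?polyXsubC_eq0 //.
  by rewrite -exprSr -Ef (dvdp_trans _ dvd) // dvdp_exp2l.
have g0 : g != 0 by apply: contraNneq ga => ->; rewrite root0.
rewrite Ef in sf *.
apply: leq_trans (weight_ge_digit_product pF a0 ga sf).
apply: digit_product_ge => //; first exact: leq_trans ck ke.
apply: leq_trans sf; rewrite size_mul ?expf_neq0 ?polyXsubC_eq0 //.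
by rewrite size_exp_XsubC addSn /= -[X in (X < _)%N]addn0 ltn_add2l size_poly_gt0.
Qed.

Lemma weight_sum (A : nzRingType) (N : nat) (I : finType) (f : I -> {poly A}) :
  (weight N (\sum_i f i)%R <= \sum_i weight N (f i))%N.
Proof.
apply: (big_ind2 (fun f w => weight N f <= w)%N) => //.
  by rewrite /weight big1 // => i _; rewrite coef0 eqxx.
move=> f1 w1 f2 w2 le1 le2; apply: leq_trans (leq_add le1 le2).
rewrite /weight -big_split; apply: leq_sum => i _; rewrite coefD.
by case: (f1`_i =P 0) => [->|_]; rewrite ?add0r // (leq_trans (leq_b1 _)).
Qed.

Lemma weight_mul_XnsubC_exp (A : comNzRingType) (N k1 k2 m1 m2 : nat) (a b : A) :
  (weight N (('X^k1 - a%:P) ^+ m1 * ('X^k2 - b%:P) ^+ m2)%R <= m1.+1 * m2.+1)%N.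
Proof.
have expand k (c : A) m : exists d : 'I_m.+1 -> A,
  ('X^k - c%:P) ^+ m = \sum_(i < m.+1) d i *: 'X^(k * (m - i)).
  exists (fun i => (- c) ^+ i *+ 'C(m, i)); rewrite exprDn; apply: eq_bigr => i _.
  by rewrite -polyCN -polyC_exp mulrC mul_polyC -exprM scalerMnl.
have [[d ->] [d' ->]] := (expand k1 a m1, expand k2 b m2).
rewrite big_distrlr /=; apply: leq_trans (weight_sum _ _) _.
apply: (@leq_trans (\sum_(i < m1.+1) \sum_(j < m2.+1) 1)); last first.
  by rewrite !sum_nat_const !card_ord muln1.
apply: leq_sum => i _; apply: leq_trans (weight_sum _ _) _.
apply: leq_sum => j _; rewrite -scalerAl -scalerAr scalerA -exprD.
set e := (_ + _)%N; rewrite /weight; case: (ltnP e N) => [eN|Ne].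
  rewrite (bigD1 (Ordinal eN)) //= big1 ?addn0 ?leq_b1 // => l /eqP le.
  rewrite coefZ coefXn; case: (l =P e :> nat) => [El|]; last first.
    by rewrite mulr0n mulr0 eqxx.
  by case: le; apply/val_inj.
rewrite big1 // => l _; rewrite coefZ coefXn ltn_eqF ?mulr0n ?mulr0 ?eqxx //.
exact: leq_trans (ltn_ord l) Ne.
Qed.

(** * Symbol-pair weight *)

Definition pair_weight (A : nzRingType) (n : nat) (f : {poly A}) : nat :=
  (\sum_(i < n) ((f`_i, f`_(ordS i)) != (0, 0))%R)%N.

Lemma pair_weight_le (A : nzRingType) (n : nat) (f : {poly A}) :
  (pair_weight n f <= 2 * weight n f)%N.
Proof.
rewrite mul2n -addnn {2}/weight (reindex_inj (@ordS_inj n)) -big_split /=.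
apply: leq_sum => i _; rewrite xpair_eqE negb_and.
by case: (f`_i == 0); rewrite ?leq_b1 // (leq_trans (leq_b1 _)).
Qed.

(* Position 2i of the pair word sees f_(2i) and f_(2i+1), position 2i+1 sees
   f_(2i+1) and f_(2i+2): each half alone dominates the weight of either
   section. *)
Lemma pair_weight_ge (A : nzRingType) (n j : nat) (f : {poly A}) :
  (j < 2)%N -> (2 * weight n (section 2 j f) <= pair_weight (2 * n) f)%N.
Proof.
rewrite [(2 * n)%N]mulnC => j2.
have wE : weight n (section 2 j f) = (\sum_(i < n) (f`_(i * 2 + j) != 0)%R)%N.
  by apply: eq_bigr => i _; rewrite coef_section.
rewrite /pair_weight.
rewrite (sum_divmod n 2 (fun i => (f`_i, f`_(i.+1 %% (n * 2))) != (0, 0) : nat)).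
rewrite big_ord_recr big_ord1 mul2n -addnn /=.
have nE i : (i < n)%N -> ((i * 2 + 0).+1 %% (n * 2) = i * 2 + 1)%N.
  by move=> lt; rewrite addn0 addn1 modn_small //; lia.
have nO i : ((i * 2 + 1).+1 %% (n * 2) = i.+1 %% n * 2)%N.
  by rewrite muln_modl; congr (_ %% _)%N; lia.
apply: leq_add.
  rewrite wE; apply: leq_sum => i _; rewrite nE // xpair_eqE negb_and addn0.
  by case: j j2 {wE} => [|[|]] // _; rewrite ?addn0; do 2 case: (_ == 0).
case: j j2 wE => [|[|]] // _ ->; last first.
  by apply: leq_sum => i _; rewrite nO xpair_eqE negb_and; do 2 case: (_ == 0).
(* The odd position [2i + 1] sees the even coefficient of the next index, cyclically, so the even
   section is summed after a cyclic shift. *)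
rewrite (reindex_inj (@ordS_inj n)) /=.
apply: leq_sum => i _; rewrite nO addn0 xpair_eqE negb_and.
by do 2 case: (_ == 0).
Qed.

Lemma section_neq0 (A : comNzRingType) (q : nat) (f : {poly A}) :
  (0 < q)%N -> f != 0 -> exists2 j, (j < q)%N & section q j f != 0.
Proof.
move=> q0 f0; have [j fj | f_eq0] := pickP (fun j : 'I_q => section q j f != 0).
  by exists j.
case/eqP: f0; rewrite (section_sum f q0) big1 // => j _.
by move/eqP: (f_eq0 j) => ->; rewrite comp_poly0 mulr0.
Qed.

Lemma pair_weight_ge2 (A : comNzRingType) (n : nat) (f : {poly A}) :
  f != 0 -> (size f <= 2 * n)%N -> (2 <= pair_weight (2 * n) f)%N.
Proof.
move=> f0 sf; have [j j2 fj] := section_neq0 (isT : (0 < 2)%N) f0.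
apply: leq_trans (pair_weight_ge _ _ j2).
rewrite -[X in (X <= _)%N]muln1 leq_mul2l /=.
apply: weight_gt0 => //; apply/leq_sizeP => i ni.
rewrite coef_section // nth_default //.
by rewrite (leq_trans sf) // (leq_trans _ (leq_addr _ _)) // mulnC leq_mul2r.
Qed.

(** Both parity sections inherit divisibility by [(X - a)^k]; the weight bound applies to a nonzero
    one. *)
Lemma pair_weight_ge_XsqrsubC (F : fieldType) (p r gamma G k : nat) (a : F)
    (f : {poly F}) :
  p \in [pchar F] -> a != 0 -> (G.+1 < p)%N ->
  (p ^ r * (p * (p ^ gamma).-1 + G) < k)%N ->
  (size f <= 2 * p ^ (r + gamma.+1))%N -> f != 0 -> ('X^2 - a%:P) ^+ k %| f ->
  (2 * (G.+2 * p ^ gamma) <= pair_weight (2 * p ^ (r + gamma.+1)) f)%N.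
Proof.
move=> pF a0 Gp ck sf f0 dvd; have [j j2 fj] := section_neq0 (isT : (0 < 2)%N) f0.
apply: leq_trans (pair_weight_ge _ _ j2); rewrite leq_mul2l /=.
apply: (weight_ge pF a0 Gp ck) => //.
  apply/leq_sizeP => i ni; rewrite coef_section // nth_default //.
  by rewrite (leq_trans sf) // (leq_trans _ (leq_addr _ _)) // mulnC leq_mul2r.
by case/dvdpP: dvd => h ->; rewrite mulrC section_mul_XnsubC_exp // dvdp_mulIl.
Qed.

(** With [r = s - gamma - 1] and [Gamma = G + 1], the identity [p^s - p^(s - gamma) = p^r p (p^gamma
    - 1)] turns the range of [mu] into the digit form of the weight bound. *)
Lemma parameter_range (p s gamma G mu : nat) :
  (0 < p)%N -> (G.+1 < p)%N -> (0 < s)%N -> (gamma <= s - 1)%N ->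
  (2 * p ^ s - p ^ (s - gamma) + (G.+1 - 1) * p ^ (s - gamma - 1) + 1 <= mu)%N ->
  (mu <= 2 * p ^ s - p ^ (s - gamma) + G.+1 * p ^ (s - gamma - 1))%N ->
  exists r, [/\ s = (r + gamma.+1)%N,
    (p ^ r * (p * (p ^ gamma).-1 + G) < mu - p ^ s)%N,
    (mu <= p ^ s + p ^ r * (p * (p ^ gamma).-1 + G.+1))%N &
    (p ^ r * (p * (p ^ gamma).-1 + G.+1) < p ^ s)%N].
Proof.
move=> p0 Gp s0 gs; pose r := (s - gamma.+1)%N.
have Es : s = (r + gamma.+1)%N by rewrite /r; lia.
have -> : (s - gamma = r.+1)%N by lia.
have q0 : (0 < p ^ r)%N by rewrite expn_gt0 p0.
have psE : (p ^ s = p ^ r * p * (p ^ gamma).-1.+1)%N.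
  by rewrite prednK ?expn_gt0 ?p0 // -mulnA -expnS -expnD -Es.
move=> lo hi; exists r; move: lo hi; rewrite !subn1 /= psE expnSr.
move: (p ^ r)%N (p ^ gamma).-1 q0 => q g q0 lo hi.
by split=> //; nia.
Qed.

(** * The ring F[u,v]/<u^2, v^2> and its constacyclic quotients *)

HB.instance Definition _ (F : fieldType) :=
  GRing.RMorphism.copy (@injF F) (qpolyC _ \o qpolyC ('X^2 : {poly F})).

Definition qeval (F : fieldType) (n : nat) (alpha : Ruv F) (f : {poly F}) :
    Rquo n alpha :=
  in_qpoly ('X^n - alpha%:P) (map_poly (@injF F) f).

HB.instance Definition _ (F : fieldType) (n : nat) (alpha : Ruv F) :=
  GRing.RMorphism.copy (@qeval F n alpha) (in_qpoly _ \o map_poly (@injF F)).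

HB.instance Definition _ (F : fieldType) (n : nat) (alpha : Ruv F) :=
  GRing.RMorphism.copy (@qconst F n alpha) (qpolyC _).

Lemma Ruv_coords_inj (F : fieldType) (a1 a2 a3 a4 b1 b2 b3 b4 : F) :
  injF a1 + injF a2 * uu F + injF a3 * vv F + injF a4 * (uu F * vv F) =
  injF b1 + injF b2 * uu F + injF b3 * vv F + injF b4 * (uu F * vv F) ->
  [/\ a1 = b1, a2 = b2, a3 = b3 & a4 = b4].
Proof.
move=> E; have [[[[c1 c2] c3] c4] [_ uniq]] :=
  Ruv_basis (injF a1 + injF a2 * uu F + injF a3 * vv F + injF a4 * (uu F * vv F)).
have aE := uniq (a1, a2, a3, a4) erefl; have bE := uniq (b1, b2, b3, b4) E.
by case: (etrans (esym aE) bE) => {aE bE E uniq} e1 e2 e3 e4; split.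
Qed.

Lemma uuvv_mul_eq0 (F : fieldType) (a : F) :
  (uu F * vv F * injF a == 0) = (a == 0).
Proof.
apply/eqP/eqP => [E|->]; last by rewrite rmorph0 mulr0.
have [|_ _ _ ->] := @Ruv_coords_inj F 0 0 0 a 0 0 0 0; last by [].
by rewrite !rmorph0 !mul0r !add0r mulrC.
Qed.

(** Annihilation by [u] kills the coordinates on [1] and [v]; annihilation by [v] then kills the one
    on [u]. *)
Lemma Ruv_socle (F : fieldType) (r : Ruv F) :
  uu F * r = 0 -> vv F * r = 0 -> exists a, r = uu F * vv F * injF a.
Proof.
have [[[[a1 a2] a3] a4] [-> _]] := Ruv_basis r => ur vr.
have u2 := uuE F; have v2 := vvE F.
have [|_ -> _ ->] := @Ruv_coords_inj F 0 a1 0 a3 0 0 0 0.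
  rewrite !rmorph0 !mul0r !addr0 !add0r -[RHS]ur.
  by ring: u2.
have [|_ _ _ ->] := @Ruv_coords_inj F 0 0 a1 a2 0 0 0 0.
  rewrite !rmorph0 !mul0r !addr0 !add0r -[RHS]vr.
  by ring: v2.
exists a4.
by rewrite !rmorph0 !mul0r !add0r mulrC.
Qed.

(** The root is lifted from [c]: the coordinates on [u], [v] and [uv] solve successive linear
    equations with invertible coefficient [2 c]. *)
Lemma Ruv_square (F : fieldType) (c a2 a3 a4 : F) :
  c != 0 -> (2 : F) != 0 ->
  exists beta : Ruv F, beta ^+ 2 =
    injF (c ^+ 2) + injF a2 * uu F + injF a3 * vv F + injF a4 * (uu F * vv F).
Proof.
move=> c0 two0; have c20 : 2 * c != 0 by rewrite mulf_neq0.
pose x2 := a2 / (2 * c); pose x3 := a3 / (2 * c).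
pose x4 := (a4 - 2 * x2 * x3) / (2 * c).
have -> : a2 = 2 * c * x2 by rewrite /x2 mulrC divfK.
have -> : a3 = 2 * c * x3 by rewrite /x3 mulrC divfK.
have -> : a4 = 2 * c * x4 + 2 * x2 * x3.
  by rewrite /x4 [2 * c * _]mulrC divfK // subrK.
exists (injF c + injF x2 * uu F + injF x3 * vv F + injF x4 * (uu F * vv F)).
rewrite !(rmorphD, rmorphM, rmorphXn, rmorph_nat) /=.
have u2 := uuE F; have v2 := vvE F.
by ring: u2 v2.
Qed.

(** * Ideals, nilpotent elements and factorization *)

Lemma unipotent_inv (A : comNzRingType) (x : A) (n : nat) :
  x ^+ n = 0 -> exists w, (1 - x) * w = 1.
Proof.
move=> xn; exists (\sum_(i < n) x ^+ i); apply: oppr_inj.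
by rewrite -mulNr opprB -subrX1 xn sub0r.
Qed.

Lemma in_ideal1 (A : comNzRingType) (g c : A) :
  in_ideal [:: g] c <-> exists a, c = a * g.
Proof.
split=> [[a ->]|[a ->]]; first by exists (a 0); rewrite big_ord1.
by exists (fun=> a); rewrite big_ord1.
Qed.

Lemma in_ideal2 (A : comNzRingType) (g h c : A) :
  in_ideal [:: g; h] c <-> exists a b, c = a * g + b * h.
Proof.
split=> [[a ->]|[a [b ->]]].
  exists (a ord0), (a ord_max); rewrite big_ord_recr big_ord1 /=.
  by congr (a _ * _ + _); apply/val_inj.
exists (fun i : 'I_2 => if i == 0 :> nat then a else b).
by rewrite big_ord_recr big_ord1.
Qed.

Lemma in_ideal_mull (A : comNzRingType) (gs : seq A) (a c : A) :
  in_ideal gs c -> in_ideal gs (a * c).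
Proof.
move=> [b ->]; exists (fun i => a * b i); rewrite mulr_sumr.
by apply: eq_bigr => i _; rewrite mulrA.
Qed.

Lemma in_idealB (A : comNzRingType) (gs : seq A) (c d : A) :
  in_ideal gs c -> in_ideal gs d -> in_ideal gs (c - d).
Proof.
move=> [a ->] [b ->]; exists (fun i => a i - b i); rewrite -sumrB.
by apply: eq_bigr => i _; rewrite mulrBl.
Qed.

(* If u y^k = a g + b u y^mu with k < mu, then u y^k (1 - b y^(mu-k)) = a g,
   and 1 - b y^(mu-k) is invertible as y is nilpotent, so u y^k lies in (g). *)
Lemma ideal_exponent_ge (A : comNzRingType) (g u y : A) (mu Im k n : nat) :
  y ^+ n = 0 -> is_least (fun k => in_ideal [:: g] (u * y ^+ k)) Im ->
  (mu < Im)%N -> in_ideal [:: g; u * y ^+ mu] (u * y ^+ k) -> (mu <= k)%N.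
Proof.
move=> yn [_ least] muIm /in_ideal2 [a [b E]].
rewrite leqNgt; apply/negP => kmu.
have [|w wE] := @unipotent_inv A (b * y ^+ (mu - k)) n.
  rewrite exprMn -exprM -(subnKC kmu) addSn subSn ?leq_addr // mulSn exprD.
  by rewrite yn mul0r mulr0.
suff /least : in_ideal [:: g] (u * y ^+ k) by rewrite leqNgt (ltn_trans kmu).
apply/in_ideal1; exists (w * a).
have -> : u * y ^+ k = w * (u * y ^+ k * (1 - b * y ^+ (mu - k))).
  by rewrite mulrCA [w * _]mulrC wE mulr1.
rewrite -[RHS]mulrA; congr (_ * _); rewrite mulrBr mulr1 {1}E.
rewrite [u * _ * _]mulrCA -[u * _ * y ^+ (mu - k)]mulrA -exprD.
by rewrite subnKC ?addrK // ltnW.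
Qed.

Lemma irreducible_factor (F : fieldType) (q f : {poly F}) :
  irreducible_poly q -> f != 0 -> exists j f1, f = q ^+ j * f1 /\ coprimep q f1.
Proof.
move=> irr; have [q1 _] := irr.
have [n] := ubnP (size f); elim: n f => // n IH f; rewrite ltnS => sf f0.
have [qf|nqf] := boolP (q %| f); last first.
  by exists 0%N, f; rewrite mul1r irreducible_poly_coprime.
have /dvdpP [g Eg] := qf.
have g0 : g != 0 by apply: contraNneq f0 => gz; rewrite Eg gz mul0r.
have q0 : q != 0 by rewrite -size_poly_gt0 ltnW.
have [|j [f1 [Ef1 cop]]] := IH g _ g0.
  apply: leq_trans sf; rewrite Eg size_mul //.
  by case: (size q) q1 => [|[|k]] // _; rewrite !addnS ltnS leq_addr.
by exists j.+1, f1; rewrite Eg Ef1 exprS mulrC mulrA.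
Qed.

(** * Codewords, constant multiples and the socle *)

Section Quotient.
Variables (F : fieldType) (n : nat) (alpha : Ruv F).
Hypothesis n_gt0 : (0 < n)%N.
Local Notation Q := (Rquo n alpha).

Lemma size_modulus : size (mk_monic ('X^n - alpha%:P)) = n.+1.
Proof. by rewrite mk_monic_Rquo // size_XnsubC. Qed.

Lemma size_Rquo (c : Q) : (size (c : {poly Ruv F}) <= n)%N.
Proof. by apply: leq_trans (size_npoly c) _; rewrite size_modulus. Qed.

(** A constant factor does not raise the degree, so no reduction modulo [X^n - alpha] occurs. *)
Lemma coef_qconstM (r : Ruv F) (c : Q) i :
  (qconst n alpha r * c : {poly Ruv F})`_i = r * (c : {poly Ruv F})`_i.
Proof.
rewrite /= -coefCM; congr (_`_i).
rewrite Pdiv.CommonRing.rmodp_small // mul_polyC.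
apply: leq_ltn_trans (leq_trans (size_scale_leq _ _) (size_Rquo c)) _.
by rewrite size_modulus.
Qed.

Lemma coef_qeval (f : {poly F}) i :
  (size f <= n)%N -> (qeval n alpha f : {poly Ruv F})`_i = injF f`_i.
Proof.
move=> sf; rewrite /= Pdiv.CommonRing.rmodp_small ?coef_map //.
rewrite size_modulus ltnS.
exact: leq_trans (size_poly _ _) sf.
Qed.

Lemma qconst_injFVM (a : F) :
  a != 0 -> qconst n alpha (injF a^-1) * qconst n alpha (injF a) = 1.
Proof.
move=> a0; transitivity (qconst n alpha (injF (a^-1 * a))).
  by rewrite !rmorphM.
rewrite (mulVf a0) (rmorph1 (@injF F)).
exact: (rmorph1 (qconst n alpha)).
Qed.

Lemma qeval_XnsubC k (a : F) :
  qeval n alpha ('X^k - a%:P) = qx n alpha ^+ k - qconst n alpha (injF a).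
Proof.
rewrite /qeval rmorphB /= map_polyXn map_polyC rmorphB rmorphXn /=.
congr (_ - _); apply/val_inj => /=.
rewrite Pdiv.CommonRing.rmodp_small // size_modulus.
by rewrite (leq_ltn_trans (size_polyC_leq1 _)).
Qed.

Lemma pair_dist_word (c d : Q) :
  pair_dist (word c) (word d) = pair_weight n (c - d : {poly Ruv F}).
Proof.
rewrite /pair_dist /pair_weight -sum1dep_card big_mkcond; apply: eq_bigr => i _.
rewrite !mxE !coefB !xpair_eqE !subr_eq0.
by case: ifP.
Qed.

Lemma pair_dist_word0 (c : Q) :
  pair_dist (word c) (word (0 : Q)) = pair_weight n (c : {poly Ruv F}).
Proof. by rewrite pair_dist_word (subr0 c). Qed.

Lemma pair_weight_qconstM (r : Ruv F) (c : Q) :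
  (pair_weight n (qconst n alpha r * c : {poly Ruv F})
     <= pair_weight n (c : {poly Ruv F}))%N.
Proof.
apply: leq_sum => i _; rewrite !coef_qconstM !xpair_eqE.
case: ((c : {poly Ruv F})`_i =P 0) => [->|_]; last by rewrite leq_b1.
case: ((c : {poly Ruv F})`_(ordS i) =P 0) => [->|_]; last by rewrite leq_b1.
by rewrite !mulr0 !eqxx.
Qed.

Lemma pair_weight_uuvv (f : {poly F}) :
  (size f <= n)%N ->
  pair_weight n (qconst n alpha (uu F * vv F) * qeval n alpha f : {poly Ruv F}) =
  pair_weight n f.
Proof.
move=> sf; apply: eq_bigr => i _.
by rewrite !coef_qconstM !(coef_qeval _ sf) !xpair_eqE !uuvv_mul_eq0.
Qed.

(** Multiply by [u], then by [v], each time only if the result stays nonzero. Since [u] and [v]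
    square to zero, both kill the outcome, whose coefficients thus lie in [uv F]. *)
Lemma socle_multiple (c : Q) :
  c != 0 -> exists r (f : {poly F}), [/\ f != 0, (size f <= n)%N &
    qconst n alpha r * c = qconst n alpha (uu F * vv F) * qeval n alpha f].
Proof.
pose U := qconst n alpha (uu F); pose V := qconst n alpha (vv F).
have UU : U * U = 0 by rewrite -rmorphM /= -expr2 uuE rmorph0.
have VV : V * V = 0 by rewrite -rmorphM /= -expr2 vvE rmorph0.
have pick (W d : Q) : W * W = 0 -> d != 0 ->
  exists2 e, (e = d \/ e = W * d) & e != 0 /\ W * e = 0.
  move=> WW d0; have [Wd|Wd] := eqVneq (W * d) 0; first by exists d; [left|].
  by exists (W * d); [right | rewrite mulrA WW mul0r].
move=> /(pick _ _ UU) [d dc [d0 Ud]].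
have [e ed [e0 Ve]] := pick _ _ VV d0.
have Ue : U * e = 0 by case: ed => ->; rewrite // mulrCA Ud mulr0.
have [r Er] : exists r, e = qconst n alpha r * c.
  case: dc ed => -> [] ->; first by exists 1; rewrite rmorph1 mul1r.
  - by exists (vv F).
  - by exists (uu F).
  by exists (vv F * uu F); rewrite rmorphM /= mulrA.
have socle i : exists a, (e : {poly Ruv F})`_i = uu F * vv F * injF a.
  apply: Ruv_socle; rewrite -coef_qconstM.
    by rewrite [_ * e]Ue coef0.
  by rewrite [_ * e]Ve coef0.
(* The boolean form lets [xchoose] select the coefficients of [f]. *)
have {}socle i : exists a, (e : {poly Ruv F})`_i == uu F * vv F * injF a.
  by have [a ->] := socle i; exists a.
pose f := \poly_(i < n) xchoose (socle i).
have sf : (size f <= n)%N := size_poly _ _.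
have Ee : e = qconst n alpha (uu F * vv F) * qeval n alpha f.
  apply/val_inj/polyP => i; rewrite coef_qconstM coef_qeval // coef_poly.
  case: ltnP => ni; first exact/eqP/(xchooseP (socle i)).
  by rewrite rmorph0 mulr0 nth_default // (leq_trans (size_Rquo _)).
exists r, f; split=> //; last by rewrite -Er.
by apply: contraNneq e0 => fz; rewrite Ee fz rmorph0 mulr0.
Qed.

End Quotient.

(** Both cases of the formula reduce to weights over [F]: [uv y^j] is a codeword of pair weight at
    most [2 d], and the last hypothesis supplies the lower bound. *)
Lemma constacyclic_pair_dist (F : fieldType) (p s n : nat)
    (alpha1 alpha2 alpha3 alpha4 alpha0 : F) (alpha : Ruv F)
    (g : Rquo n alpha) (mu Im j d : nat) :
  p \in [pchar F] -> n = (2 * p ^ s)%N -> alpha3 != 0 ->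
  alpha = injF alpha1 + injF alpha2 * uu F + injF alpha3 * vv F
          + injF alpha4 * (uu F * vv F) ->
  alpha0 ^+ (p ^ s) = alpha1 -> irreducible_poly ('X^2 - alpha0%:P) ->
  is_least (fun k => in_ideal [:: g] (qu * qy alpha0 ^+ k)) Im -> (mu < Im)%N ->
  (mu <= p ^ s + j)%N -> (j < p ^ s)%N ->
  (weight n (('X^2 - alpha0%:P) ^+ j) <= d)%N ->
  (forall f : {poly F}, f != 0 -> (size f <= n)%N ->
     ('X^2 - alpha0%:P) ^+ (mu - p ^ s) %| f -> (2 * d <= pair_weight n f)%N) ->
  is_pair_dist_of (code (in_ideal [:: g; qu * qy alpha0 ^+ mu])) (2 * d).
Proof.
move=> pF nE a3 halpha halpha0 irrY hIm hmu muj jp wd low.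
have ps0 : (0 < p ^ s)%N by rewrite expn_gt0 prime_gt0 ?(pcharf_prime pF).
have n0 : (0 < n)%N by rewrite nE muln_gt0.
set Y := 'X^2 - _ in irrY wd low; set C := code _.
have sY : size Y = 3 by rewrite size_XnsubC.
pose ev := qeval n alpha; pose cst := qconst n alpha.
pose uv := cst (uu F * vv F).
have yE : qy alpha0 = ev Y by rewrite /ev (qeval_XnsubC alpha n0).
pose nu := alpha - injF alpha1.
have u2 := uuE F; have v2 := vvE F.
(* Here [nu] lies in the ideal generated by [u] and [v], whose cube vanishes. *)
have nu3 : nu ^+ 3 = 0.
  by rewrite /nu halpha; ring: u2 v2.
have unu : uu F * nu = uu F * vv F * injF alpha3.
  by rewrite /nu halpha; ring: u2.
have uvnu : uu F * vv F * nu = 0.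
  by rewrite /nu halpha; ring: u2 v2.
have yps : ev Y ^+ (p ^ s) = cst nu.
  rewrite -rmorphXn /= /Y (XnsubC_exp_pchar 2 s alpha0 pF) -nE halpha0.
  by rewrite /ev (qeval_XnsubC alpha n0) (qx_exp alpha n0) -rmorphB.
have ynil : ev Y ^+ (p ^ s * 3) = 0.
  by rewrite (exprM (ev Y)) yps -rmorphXn nu3 (rmorph0 cst).
pose I := in_ideal [:: g; qu * qy alpha0 ^+ mu].
(* As [alpha3] is invertible, [uv y^i] and [u y^(p^s + i)] generate the same ideal. *)
have uvY i : I (uv * ev Y ^+ i) <-> (mu <= p ^ s + i)%N.
  have uE : qu * ev Y ^+ (p ^ s + i) = cst (injF alpha3) * (uv * ev Y ^+ i).
    by rewrite exprD yps mulrA -rmorphM /= unu rmorphM /= mulrA [_ * uv]mulrC.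
  split=> [Ij | mui].
    have /ideal_exponent_ge := ynil; rewrite -yE => /(_ _ _ _ _ _ hIm hmu); apply.
    by rewrite yE uE; rewrite /I yE in Ij; apply: in_ideal_mull.
  have -> : uv * ev Y ^+ i = cst (injF alpha3^-1) * (qu * ev Y ^+ (p ^ s + i)).
    by rewrite uE [RHS]mulrA (qconst_injFVM n alpha a3) mul1r.
  apply: in_ideal_mull; apply/in_ideal2; exists 0, (ev Y ^+ (p ^ s + i - mu)).
  by rewrite mul0r add0r yE mulrCA -exprD subnK.
have evM f f' : ev (f * f') = ev f * ev f' by exact: (rmorphM (qeval n alpha)).
have evD f f' : ev (f + f') = ev f + ev f' by exact: (rmorphD (qeval n alpha)).
have evX f i : ev (f ^+ i) = ev f ^+ i by exact: (rmorphXn (qeval n alpha)).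
have lower x y : C x -> C y -> x <> y -> exists f : {poly F},
    [/\ f != 0, (size f <= n)%N, Y ^+ (mu - p ^ s) %| f
      & (pair_weight n f <= pair_dist x y)%N].
  move=> [c [Ic ->]] [c' [Ic' ->]] cd.
  have cd0 : c - c' != 0 by apply/eqP => /subr0_eq E; case: cd; rewrite E.
  have [r [f [f0 sf Ef]]] := socle_multiple n0 cd0; exists f; split=> //.
    have [i [f1 [Ef1 cop]]] := irreducible_factor irrY f0.
    (* Bezout against [Y^(p^s)] suffices: [uv] annihilates its image [nu], so [b2] inverts [f1] on
       multiples of [uv]. *)
    have /Bezout_eq1_coprimepP [[b1 b2] /= bez] : coprimep (Y ^+ (p ^ s)) f1.
      by rewrite coprimep_expl.
    rewrite Ef1 dvdp_mulr // dvdp_exp2l // leq_subLR; apply/uvY.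
    have -> : uv * ev Y ^+ i = ev b2 * (uv * ev f).
      rewrite Ef1 evM evX.
      have uvb : uv * (ev b1 * ev Y ^+ (p ^ s)) = 0.
        by rewrite yps mulrCA -rmorphM /= uvnu rmorph0 mulr0.
      have evb : ev b2 * ev f1 = 1 - ev b1 * ev Y ^+ (p ^ s).
        apply: (canRL (addrK _)); rewrite -evX -!evM -evD [b2 * _ + _]addrC bez.
        exact: (rmorph1 (qeval n alpha)).
      have -> : ev b2 * (uv * (ev Y ^+ i * ev f1)) =
                uv * (ev b2 * ev f1) * ev Y ^+ i by ring.
      by rewrite evb mulrBr (mulr1 uv) uvb (subr0 uv).
    by apply: in_ideal_mull; rewrite -Ef; apply/in_ideal_mull/in_idealB.
  rewrite pair_dist_word -(pair_weight_uuvv alpha n0 sf) -Ef.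
  exact: pair_weight_qconstM.
have Y0 : Y ^+ j != 0 by rewrite expf_neq0 // -size_poly_gt0 sY.
have sYj : (size (Y ^+ j)%R <= n)%N.
  by rewrite -[size _]prednK ?size_poly_gt0 // size_exp sY nE; lia.
have pdE : pair_dist (word (uv * ev (Y ^+ j))) (word (0 : Rquo n alpha)) =
           pair_weight n (Y ^+ j).
  rewrite pair_dist_word0; exact: (pair_weight_uuvv alpha n0 sYj).
have {}low x y : C x -> C y -> x <> y -> (2 * d <= pair_dist x y)%N.
  move=> Cx Cy xy; have [f [f0 sf Yf]] := lower x y Cx Cy xy.
  exact: leq_trans (low f f0 sf Yf).
split=> //; exists (word (uv * ev (Y ^+ j))), (word (0 : Rquo n alpha)).
have Cx : C (word (uv * ev (Y ^+ j))).
  by exists (uv * ev (Y ^+ j)); split=> //; rewrite evX; apply/uvY.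
have C0 : C (word (0 : Rquo n alpha)).
  by exists 0; split=> //; apply/in_ideal2; exists 0, 0; rewrite !mul0r addr0.
have xy : word (uv * ev (Y ^+ j)) <> word (0 : Rquo n alpha).
  (* Equal words would give pair weight zero, but [Y^j] is nonzero and has pair weight at least
     2. *)
  move=> E; have := @pair_weight_ge2 _ (p ^ s) _ Y0.
  rewrite -nE -pdE E pair_dist_word0 => /(_ sYj).
  by rewrite /pair_weight big1 // => i _; rewrite !coef0 eqxx.
split=> //; apply/eqP; rewrite eqn_leq low // andbT pdE.
by rewrite (leq_trans (pair_weight_le _ _)) // leq_mul2l.
Qed.

Theorem theorem5p4
  (p m s : nat) (hp : prime p) (hodd : odd p) (hm : (0 < m)%N) (hs : (0 < s)%N)
  (F : finFieldType) (hF : #|F| = (p ^ m)%N)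
  (alpha1 alpha2 alpha3 alpha4 : F)
  (h1 : alpha1 <> 0) (h2 : alpha2 <> 0) (h3 : alpha3 <> 0)
  (alpha : Ruv F)
  (halpha : alpha = injF alpha1 + injF alpha2 * uu F + injF alpha3 * vv F
                    + injF alpha4 * (uu F * vv F))
  (hnsq : ~ exists beta : Ruv F, beta ^+ 2 = alpha)
  (alpha0 : F) (halpha0 : alpha0 ^+ (p ^ s) = alpha1)
  (l t mu Im : nat) (z : Rquo (2 * p ^ s) alpha)
  (hl : (l <= 2 * p ^ s - 1)%N) (ht : (t < l)%N)
  (hz : z = 0 \/ is_represented_unit alpha0 z)
  (hIm : is_least
    (fun k => in_ideal [:: qy alpha0 ^+ l + qu * qy alpha0 ^+ t * z]
                       (qu * qy alpha0 ^+ k)) Im)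
  (hmu : (mu < Im)%N) :
  let C := code (in_ideal [:: qy alpha0 ^+ l + qu * qy alpha0 ^+ t * z;
                              qu * qy alpha0 ^+ mu]) in
  ((mu <= p ^ s)%N -> is_pair_dist_of C 2) /\
  (forall Gamma gamma : nat,
    (1 <= Gamma <= p - 1)%N -> (gamma <= s - 1)%N ->
    (2 * p ^ s - p ^ (s - gamma) + (Gamma - 1) * p ^ (s - gamma - 1) + 1
       <= mu <=
     2 * p ^ s - p ^ (s - gamma) + Gamma * p ^ (s - gamma - 1))%N ->
    is_pair_dist_of C (2 * (Gamma + 1) * p ^ gamma)%N).
Proof.
move=> C; have pF : p \in [pchar F] := card_finPcharP hF hp.
have p0 := prime_gt0 hp.
have ps0 : (0 < p ^ s)%N by rewrite expn_gt0 p0.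
have two0 : (2 : F) != 0.
  rewrite -(dvdn_pcharf pF); apply: contraTN hodd => /(dvdn_leq (ltn0Sn 1)) p2.
  by have -> : p = 2%N by apply/eqP; rewrite eqn_leq p2 prime_gt1.
have a0 : alpha0 != 0.
  by apply/eqP => az; case: h1; rewrite -halpha0 az expr0n eqn0Ngt ps0.
pose Y := 'X^2 - alpha0%:P.
have sY : size Y = 3 by rewrite size_XnsubC.
(* A root [x] of this quadratic would make [alpha1] the nonzero square of [x^(p^s)], and then
   [alpha] a square. *)
have irrY : irreducible_poly Y.
  apply: cubic_irreducible => [|x]; first by rewrite sY.
  rewrite rootE !hornerE subr_eq0; apply/eqP => xa; case: hnsq; rewrite halpha.
  have -> : alpha1 = (x ^+ (p ^ s)) ^+ 2 by rewrite exprAC xa.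
  apply: Ruv_square => //; rewrite expf_neq0 //.
  by apply: contraNneq a0 => xz; rewrite -xa xz expr0n.
have a3 : alpha3 != 0 by apply/eqP.
have dist d j := constacyclic_pair_dist (d := d) (j := j)
  pF erefl a3 halpha halpha0 irrY hIm hmu.
split=> [mups | Gamma gamma /andP[G1 Gp] gs /andP[lo hi]].
  (* The constant word [uv] attains the minimum. *)
  apply: (dist 1%N 0%N); rewrite ?addn0 //.
    have := weight_mul_XnsubC_exp (2 * p ^ s) 2 2 0 0 alpha0 alpha0.
    by rewrite expr0 mulr1.
  by move=> f f0 sf _; apply: pair_weight_ge2.
case: Gamma G1 Gp lo hi => // G _ Gp lo hi.
have Gp' : (G.+1 < p)%N by rewrite -(prednK p0) ltnS -subn1.
have [r [Es ck muj jp]] := parameter_range p0 Gp' hs gs lo hi.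
rewrite -mulnA addn1; apply: (dist _ _ muj jp).
  (* By Frobenius, [Y^j] is a binomial to the power [p^gamma - 1] times a binomial to the power
     [G + 1], hence has at most [p^gamma (G + 2)] terms. *)
  rewrite mulnDr mulnA -expnSr exprD !exprM !XnsubC_exp_pchar //.
  rewrite -[X in (_ <= _ * X)%N]prednK ?expn_gt0 ?p0 // [X in (_ <= X)%N]mulnC.
  exact: weight_mul_XnsubC_exp.
move=> f f0 sf Yf; rewrite Es in sf *.
exact: (pair_weight_ge_XsqrsubC pF a0 Gp' ck).
Qed.
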